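(* Let $1\le n<5$ and let $\varphi:T^n\to T^n$ be a minimal homeomorphism of the torus $T^n=\mathbb{R}^n/\mathbb{Z}^n$. Let $L$ be the linear part of $\varphi$. Then $L$ is quasi-unipotent, and $1$ is an eigenvalue of $L$.
   Context: A homeomorphism is minimal if all of its orbits are dense. The linear part of a homeomorphism $\varphi$ of $T^n$ is the linear map $L\in GL(n,\mathbb{Z})$ induced by $\varphi$ on the first homology group $H_1(T^n,\mathbb{Z})\cong\mathbb{Z}^n$; equivalently, $\varphi$ lifts to $\mathbb{R}^n$ as $x\mapsto Lx+F(x)$ with $F$ continuous and $\mathbb{Z}^n$-periodic. A matrix $L\in GL(n,\mathbb{Z})$ is quasi-unipotent if all of its (complex) eigenvalues are roots of unity. *)

(* Defs.v *)
From HB Require Import structures.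
From mathcomp Require Import all_boot all_order all_algebra.
From mathcomp Require Import generic_quotient complex.
From mathcomp Require Import all_classical all_reals all_analysis.
Set Implicit Arguments.
Unset Strict Implicit.
Unset Printing Implicit Defensive.
Import Order.TTheory GRing.Theory Num.Theory.
Import numFieldNormedType.Exports.
Local Open Scope classical_set_scope.
Local Open Scope quotient_scope.
Local Open Scope ring_scope.

Section Torus.
Variables (R : realType) (n : nat).

Definition lattice_vec (m : 'cV[int]_n) : 'cV[R]_n := map_mx intr m.

Definition lattice_rel : rel 'cV[R]_n :=
  fun x y => `[< exists m : 'cV[int]_n, x - y = lattice_vec m >].

Lemma lattice_rel_refl : reflexive lattice_rel.
Proof.
move=> x; apply/asboolP; exists 0.
by rewrite subrr; apply/matrixP => i j; rewrite !mxE.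
Qed.

Lemma lattice_rel_sym : symmetric lattice_rel.
Proof.
suff sym x y : lattice_rel x y -> lattice_rel y x.
  by move=> x y; apply/idP/idP; exact: sym.
move=> /asboolP[m xym]; apply/asboolP; exists (- m).
by rewrite -opprB xym; apply/matrixP => i j; rewrite !mxE rmorphN.
Qed.

Lemma lattice_rel_trans : transitive lattice_rel.
Proof.
move=> y x z /asboolP[m xym] /asboolP[p yzp]; apply/asboolP; exists (m + p).
rewrite -(subrKA y) xym yzp.
by apply/matrixP => i j; rewrite !mxE rmorphD.
Qed.

Canonical lattice_equiv :=
  EquivRel lattice_rel lattice_rel_refl lattice_rel_sym lattice_rel_trans.

Definition torus : Type := quotient_topology {eq_quot lattice_equiv}.

HB.instance Definition _ := Topological.on torus.
HB.instance Definition _ := Quotient.on torus.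

Definition torus_proj (x : 'cV[R]_n) : torus := \pi_torus x.

(* [L] is the matrix of the action on H_1(T^n, Z) = Z^n: some lift of [phi] to
   R^n is the sum of [L] and a continuous Z^n-periodic map. *)
Definition is_linear_part (phi : torus -> torus) (L : 'M[int]_n) : Prop :=
  L \in unitmx /\
  exists F : 'cV[R]_n -> 'cV[R]_n,
    [/\ continuous F,
        forall x (m : 'cV[int]_n), F (x + lattice_vec m) = F x
      & forall x, phi (torus_proj x) =
                  torus_proj ((map_mx intr L : 'M[R]_n) *m x + F x)].

Definition complex_mx (L : 'M[int]_n) : 'M[R[i]]_n := map_mx intr L.

Definition quasi_unipotent (L : 'M[int]_n) : Prop :=
  forall a : R[i], eigenvalue (complex_mx L) a ->
    exists2 k : nat, (0 < k)%N & a ^+ k = 1.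

End Torus.

Arguments quasi_unipotent R {n} L.
Arguments complex_mx R {n} L.

Definition homeomorphism (S T : topologicalType) (f : S -> T) : Prop :=
  continuous f /\ exists g : T -> S, [/\ cancel f g, cancel g f & continuous g].

(* For bijective [f] this is the full orbit of [x], negative iterates included. *)
Definition orbit_set (T : Type) (f : T -> T) (x : T) : set T :=
  [set y | exists k : nat, y = iter k f x \/ x = iter k f y].

Definition minimal (T : topologicalType) (f : T -> T) : Prop :=
  forall x : T, dense (orbit_set f x).

(* Main.v *)
Require Import Defs.
From mathcomp Require Import all_boot all_order all_algebra.
From mathcomp Require Import generic_quotient complex.
From mathcomp Require Import all_classical all_reals all_analysis.
From mathcomp Require Import ring lra zify.
Set Implicit Arguments.
Unset Strict Implicit.
Unset Printing Implicit Defensive.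
Import Order.TTheory GRing.Theory Num.Theory.
Import numFieldNormedType.Exports.
Local Open Scope classical_set_scope.
Local Open Scope ring_scope.

(** Write Phi(x) = L x + F(x) for the given lift of phi; F is continuous and
    periodic, hence bounded. Both assertions rest on one consequence of
    Brouwer's theorem, [bounded_perturbation_surj]: if P is a surjective linear
    map and f is continuous and bounded, then P x + f(x) = 0 has a solution.

    The eigenvalue 1. If L - 1 is invertible, then (L - 1) x + F(x) = 0 has a
    solution, so phi has a fixed point. Its orbit is a single point, which is
    not dense in a torus of positive dimension.

    Quasi-unipotence. Let a be an eigenvalue that is not a root of unity. The
    characteristic polynomial is divisible by X - 1, so a is a root of an
    integer polynomial of degree at most 3, and dividing out all factors X - 1
    and X + 1 leaves a monic integer q with q(a) = 0, q(0) = +-1 and q(1), q(-1)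
    nonzero. Such a q of degree at most 3 is irreducible over the rationals, and
    it has no root on the unit circle: a cubic with such a root would vanish at
    1 or -1, and for a quadratic all roots would be roots of unity. This is
    where n < 5 enters, since a Salem polynomial of degree 4 has roots both on
    and off the circle. Choose an integer row vector v <> 0 with v q(L) = 0; by
    irreducibility v, v L, ..., v L^(d-1) are linearly independent, where d is
    the degree of q ([exists_hyperbolic_factor]).

    Then argue as Franks does for hyperbolic toral automorphisms. Composition
    with phi is an operator T on bounded continuous functions on the torus, and
    q(T) is onto because each factor T - z with |z| <> 1 is inverted by a
    geometric series ([poly_shift_surj]). Hence v x can be corrected by such a
    function u to s(x) = v x + u(x mod Z^n) for which the sequence s(Phi^i x)
    satisfies the linear recurrence with characteristic polynomial q. The map
    x |-> (s(x), ..., s(Phi^(d-1) x)) is a bounded perturbation of a surjective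
    linear map, so it vanishes at some x0. The recurrence can be solved in both
    directions over the integers, as q is monic and q(0) = +-1, and translating
    x by m in Z^n changes s(x) by the integer v m; therefore s is integral at
    every lift of every point of the orbit of x0. But the set where s is not
    integral is open, invariant under Z^n and nonempty, which contradicts the
    density of that orbit ([minimal_no_integral_functional]). *)

(** * Finding a cell by a discrete cup product *)

Section Grid.
Variable I : finType.
Implicit Types (z y : {ffun I -> nat}) (D : {set I}) (js : seq I).

Let vertex := {ffun I -> nat}.

Definition step z j : vertex := [ffun i => (z i + (i == j))%N].
Definition set_coord z j t : vertex := [ffun i => if i == j then t else z i].

Lemma stepC z j k : step (step z j) k = step (step z k) j.
Proof. by apply/ffunP => i; rewrite !ffunE addnAC. Qed.

Lemma set_coordC z j k s t : j != k ->
  set_coord (set_coord z j s) k t = set_coord (set_coord z k t) j s.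
Proof.
move=> jk; apply/ffunP => i; rewrite !ffunE.
by case: eqP => // ->; rewrite eq_sym (negbTE jk).
Qed.

Lemma step_set_coord z j t : step (set_coord z j t) j = set_coord z j t.+1.
Proof. by apply/ffunP => i; rewrite !ffunE; case: eqP; rewrite ?addn1 ?addn0. Qed.

Lemma F2_addrr (x : 'F_2) : x + x = 0.
Proof. by apply: addrr_pchar2; rewrite pchar_Fp. Qed.

Lemma sum_offdiagC D (g : I -> I -> 'F_2) :
  \sum_(j in D) \sum_(k in D :\ j) g j k =
  \sum_(j in D) \sum_(k in D :\ j) g k j.
Proof.
rewrite (exchange_big_dep (mem D)) /=; last by move=> i j _ /finset.setD1P[].
apply: eq_bigr => j jD; apply: eq_bigl => k.
by rewrite !inE jD andbT eq_sym andbC.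
Qed.

(** In characteristic 2 the terms (j, k) and (k, j) cancel; working over 'F_2
    spares all the signs of the cochain calculus below. *)
Lemma sum_offdiag_sym D (g : I -> I -> 'F_2) : (forall j k, g j k = g k j) ->
  \sum_(j in D) \sum_(k in D :\ j) g j k = 0.
Proof.
move=> gC; pose below (j k : I) := (enum_rank j < enum_rank k)%N.
under eq_bigr => j _ do rewrite (bigID (below j)) /=.
rewrite big_split /= [X in _ + X](_ : _ =
  \sum_(j in D) \sum_(k in D :\ j | below j k) g j k) ?F2_addrr //.
rewrite [RHS](exchange_big_dep (mem D)) /=; last first.
  by move=> i j _ /andP[/finset.setD1P[]].
apply: eq_bigr => j jD; apply: eq_big => [k|k _]; last exact: gC.
rewrite !inE jD andbT /below -leqNgt ltn_neqAle.
have -> : (nat_of_ord (enum_rank k) != enum_rank j) = (k != j).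
  by rewrite val_eqE (inj_eq enum_rank_inj).
by rewrite [j == k]eq_sym; case: (k == j); rewrite ?andbF ?andbT.
Qed.

Variable a : I -> vertex -> 'F_2.

(** The cup product of the coboundaries of the functions [a i], for [i] in
    [js], evaluated on the cube of corner [z] with directions [D]: a sum over
    the monotone edge paths that leave [z] in directions taken from [D]. *)
Fixpoint cup js D z : 'F_2 :=
  if js is i :: js' then
    \sum_(j in D) (a i (step z j) + a i z) * cup js' (D :\ j) (step z j)
  else 1.

(** A cup product of coboundaries is a cocycle: its sum over all the faces of a
    cube vanishes. The faces through the far corner are on the left, those
    through [z] on the right. *)
Lemma cup_cocycle js D z :
  \sum_(j in D) cup js (D :\ j) (step z j) = \sum_(j in D) cup js (D :\ j) z.
Proof.
elim: js D z => [//|i js IH] D z /=; set g := cup js.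
have swapD j k : D :\ j :\ k = D :\ k :\ j.
  by rewrite !finset.setDDl finset.setUC.
(* Both sides reduce to the same middle term: the terms in a i at two steps
   from z, and those in a i z, are symmetric in (j, k). *)
transitivity (\sum_(j in D) \sum_(k in D :\ j)
     a i (step z j) * g (D :\ j :\ k) (step z j)).
  under eq_bigr => j _ do under eq_bigr => k _ do rewrite mulrDl.
  under eq_bigr => j _ do rewrite big_split.
  rewrite big_split /= sum_offdiag_sym ?add0r => [|j k].
    by apply: eq_bigr => j _; rewrite -!mulr_sumr IH.
  by rewrite stepC swapD.
under [RHS]eq_bigr => j _ do under eq_bigr => k _ do rewrite mulrDl.
under [RHS]eq_bigr => j _ do rewrite big_split.
rewrite big_split /= [X in _ = _ + X](_ : _ = 0) ?addr0; last first.
  under eq_bigr => j _ do rewrite -mulr_sumr IH mulr_sumr.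
  by apply: sum_offdiag_sym => j k; rewrite swapD.
by rewrite [RHS]sum_offdiagC; apply: eq_bigr => j _; apply: eq_bigr => k _; rewrite swapD.
Qed.

(** Paths in directions other than [j] stay in the hyperplane of coordinate
    [c], where [a j] has no variation. *)
Lemma cup_face js D z j c : j \in js -> j \notin D -> z j = c ->
  (forall x y : vertex, x j = c -> y j = c -> a j x = a j y) -> cup js D z = 0.
Proof.
elim: js D z => [//|i js IH] D z /= jjs jD zj cst.
apply: big1 => k kD; have stepj : step z k j = c.
  by rewrite ffunE zj; case: eqP kD jD => [<- ->|_ _ _]; rewrite ?addn0.
case/predU1P: jjs => [ji|jjs].
  by rewrite -ji (cst _ z) // F2_addrr mul0r.
by rewrite (IH _ _ jjs) ?mulr0 // !inE negb_and jD orbT.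
Qed.

Lemma cup_neq0 js D z j : cup js D z != 0 -> j \in js ->
  exists x y : vertex, [/\ a j x != a j y,
    forall i, (z i <= x i <= (z i).+1)%N & forall i, (z i <= y i <= (z i).+1)%N].
Proof.
suff gen : cup js D z != 0 -> j \in js -> exists x y : vertex, [/\ a j x != a j y,
    forall i, (z i <= x i <= z i + (i \in D))%N &
    forall i, (z i <= y i <= z i + (i \in D))%N].
  move=> W jjs; have [x [y [axy zx zy]]] := gen W jjs; exists x, y; split=> // i.
    by have /andP[-> /leq_trans->] := zx i; case: (_ \in D); rewrite ?addn0 ?addn1.
  by have /andP[-> /leq_trans->] := zy i; case: (_ \in D); rewrite ?addn0 ?addn1.
elim: js D z => [//|i js IH] D z /= + jjs.
have [/existsP[k /andP[kD nz]] _|] :=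
  boolP [exists k in D, (a i (step z k) + a i z) * cup js (D :\ k) (step z k) != 0].
  have [nz1 nz2] : a i (step z k) + a i z != 0 /\ cup js (D :\ k) (step z k) != 0.
    by split; apply: contraNneq nz => ->; rewrite ?mul0r ?mulr0.
  have lift x l : (step z k l <= x l <= step z k l + (l \in D :\ k))%N ->
      (z l <= x l <= z l + (l \in D))%N.
    move=> /andP[lo hi]; apply/andP; split.
      by apply: leq_trans lo; rewrite ffunE leq_addr.
    apply: leq_trans hi _; rewrite ffunE !inE.
    by case: eqP => [->|_]; rewrite ?kD ?addn0.
  case/predU1P: jjs => [->|jjs].
    exists (step z k), z; split=> [|l|l]; last by rewrite leqnn leq_addr.
      by apply: contraNneq nz1 => ->; rewrite F2_addrr.
    by apply: lift; rewrite leqnn leq_addr.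
  have [x [y [axy zx zy]]] := IH _ _ nz2 jjs.
  by exists x, y; split=> // l; apply: lift.
rewrite negb_exists => /forallP none; rewrite big1 ?eqxx // => k kD.
by apply/eqP; have := none k; rewrite kD negbK.
Qed.

Variable N : nat.

(** Iterated one coordinate at a time, so that a coboundary telescopes in a single
    direction. *)
Fixpoint boxsum js (f : vertex -> 'F_2) z : 'F_2 :=
  if js is j :: js' then \sum_(t < N) boxsum js' f (set_coord z j t) else f z.

Lemma eq_boxsum js f g z : f =1 g -> boxsum js f z = boxsum js g z.
Proof.
by move=> fg; elim: js z => //= j js IH z; apply: eq_bigr => t _.
Qed.

Lemma boxsum_sum js (T : Type) (s : seq T) (P : pred T) (f : T -> vertex -> 'F_2) z :
  boxsum js (fun z => \sum_(i <- s | P i) f i z) z = \sum_(i <- s | P i) boxsum js (f i) z.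
Proof.
elim: js z => //= j js IH z; rewrite exchange_big /=.
by apply: eq_bigr => t _.
Qed.

Lemma boxsum_set_coord js f j t z : j \notin js ->
  boxsum js f (set_coord z j t) = boxsum js (fun y => f (set_coord y j t)) z.
Proof.
elim: js z => //= k js IH z; rewrite inE negb_or => /andP[jk jjs].
by apply: eq_bigr => s _; rewrite set_coordC // IH.
Qed.

Lemma boxsum_rem js f j z : uniq js -> j \in js ->
  boxsum js f z = boxsum (rem j js) (fun y => \sum_(t < N) f (set_coord y j t)) z.
Proof.
elim: js z => //= k js IH z /andP[kjs ujs]; rewrite inE.
case: (eqVneq j k) => [-> _|jk /= jjs].
  rewrite boxsum_sum; apply: eq_bigr => t _; exact: boxsum_set_coord.
by apply: eq_bigr => t _; apply: IH.
Qed.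

Lemma boxsum_telescope js f j z : uniq js -> j \in js ->
  boxsum js (fun y => f (step y j) + f y) z =
  boxsum (rem j js) (fun y => f (set_coord y j N) + f (set_coord y j 0)) z.
Proof.
move=> ujs jjs; rewrite (boxsum_rem _ _ ujs jjs); apply: eq_boxsum => y.
rewrite big_split /=; under eq_bigr => t _ do rewrite step_set_coord.
case: N => [|M]; first by rewrite !big_ord0 F2_addrr addr0.
rewrite big_ord_recr big_ord_recl /=.
set S := \sum_(i < M) _.
by rewrite [LHS](AC (2*2) ((1*4)*(2*3))) /= F2_addrr add0r.
Qed.

Lemma boxsum_neq0 js f z : uniq js -> boxsum js f z != 0 ->
  exists y : vertex, [/\ f y != 0, forall i, i \in js -> (y i < N)%N
              & forall i, i \notin js -> y i = z i].
Proof.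
elim: js z => [|j js IH] z /=; first by exists z.
move=> /andP[jjs ujs].
have [/existsP[t nz] _|] := boolP [exists t : 'I_N, boxsum js f (set_coord z j t) != 0].
  have [y [fy yN yz]] := IH _ ujs nz; exists y; split=> // i.
    rewrite inE => /predU1P[->|]; last exact: yN.
    by rewrite yz // ffunE eqxx.
  by rewrite inE negb_or => /andP[/negbTE ij ijs]; rewrite yz // ffunE ij.
rewrite negb_exists => /forallP none; rewrite big1 ?eqxx // => t _.
by apply/eqP; have := none t; rewrite negbK.
Qed.

Hypothesis a_lo : forall j z, z j = 0%N -> a j z = 0.
Hypothesis a_hi : forall j z, z j = N -> a j z = 1.

(** Discrete Stokes formula: by the cocycle property the cup product is the
    coboundary of [a j0] times the product of the remaining factors, so the sum
    over the box telescopes to its boundary. Of all the facets only z_j0 = N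
    contributes, because [a j0] is 0 on the opposite one and some other factor
    is constant on each of the others; the sum over that facet is the same
    statement in one dimension less. *)
Lemma boxsum_cup js z : uniq js -> boxsum js (cup js [set j in js]) z = 1.
Proof.
elim: js z => [//|j0 js IH] z ujs.
have /andP[j0js ujs'] := ujs.
set D := [set j in j0 :: js].
pose h j y := a j0 y * cup js (D :\ j) y.
have -> : boxsum (j0 :: js) (cup (j0 :: js) D) z =
    boxsum (j0 :: js) (fun y => \sum_(j in D) (h j (step y j) + h j y)) z.
  apply: eq_boxsum => y; rewrite big_split /= -mulr_sumr -cup_cocycle mulr_sumr.
  by rewrite -big_split; apply: eq_bigr => j _ /=; rewrite mulrDl.
rewrite boxsum_sum (bigD1 j0) ?inE ?eqxx //= -/(boxsum (j0 :: js) _ z).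
rewrite [X in _ + X]big1 ?addr0 => [|j].
  rewrite (boxsum_telescope _ _ ujs) ?inE ?eqxx //= eqxx -(IH (set_coord z j0 N) ujs').
  rewrite boxsum_set_coord //; apply: eq_boxsum => y.
  rewrite /h a_hi ?ffunE ?eqxx // a_lo ?ffunE ?eqxx // mul1r mul0r addr0.
  congr cup; apply/finset.setP => i; rewrite !inE.
  by case: eqVneq => // ->; rewrite (negbTE j0js).
rewrite !inE => /andP[/predU1P[->|jjs] jj0]; first by rewrite eqxx in jj0.
rewrite -[LHS]/(boxsum (j0 :: js) (fun y => h j (step y j) + h j y) z).
rewrite (boxsum_telescope _ _ ujs) ?inE ?jjs ?orbT //.
rewrite (_ : boxsum _ _ z = boxsum (rem j (j0 :: js)) (fun=> 0) z).
  by elim: (rem _ _) z => //= k l IHl z; apply: big1.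
apply: eq_boxsum => y; rewrite /h.
have face c : c = N \/ c = 0%N -> cup js (D :\ j) (set_coord y j c) = 0.
  move=> cN; apply: (@cup_face _ _ _ j c) => //; rewrite ?ffunE ?inE ?eqxx //.
  move=> u v uj vj; case: cN => cE.
    by rewrite (a_hi (etrans uj cE)) (a_hi (etrans vj cE)).
  by rewrite (a_lo (etrans uj cE)) (a_lo (etrans vj cE)).
by rewrite !face ?mulr0 ?addr0; auto.
Qed.

End Grid.

(** Since the sum in [boxsum_cup] is 1, some cell carries a nonzero cup product,
    and along an edge path of that cell every [a j] changes value. *)
Lemma discrete_poincare_miranda (d N : nat) (a : 'I_d -> {ffun 'I_d -> nat} -> bool) :
  (forall j (z : {ffun 'I_d -> nat}), z j = 0%N -> a j z = false) ->
  (forall j (z : {ffun 'I_d -> nat}), z j = N -> a j z = true) ->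
  exists2 z : {ffun 'I_d -> nat}, (forall i, (z i < N)%N) &
  forall j, exists x y : {ffun 'I_d -> nat}, [/\ a j x, ~~ a j y,
    forall i, (z i <= x i <= (z i).+1)%N & forall i, (z i <= y i <= (z i).+1)%N].
Proof.
move=> lo hi; pose b j (z : {ffun 'I_d -> nat}) : 'F_2 := (a j z)%:R.
have := @boxsum_cup _ b N _ _ (enum 'I_d) [ffun=> 0%N] (enum_uniq _).
have b_lo j (z : {ffun 'I_d -> nat}) : z j = 0%N -> b j z = 0 by move=> /lo; rewrite /b => ->.
have b_hi j (z : {ffun 'I_d -> nat}) : z j = N -> b j z = 1 by move=> /hi; rewrite /b => ->.
move=> /(_ b_lo b_hi) one.
have [z [Wz zN _]] := @boxsum_neq0 _ N (enum 'I_d) _ _ (enum_uniq _)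
  (etrans (congr1 (fun x => x != 0) one) (oner_neq0 _)).
exists z => [i|j]; first by apply: zN; rewrite mem_enum.
have [|x [y [bxy zx zy]]] := cup_neq0 (j := j) Wz; first by rewrite mem_enum.
case ax: (a j x); case ay: (a j y); rewrite /b ax ay ?eqxx // in bxy.
  by exists x, y; rewrite ax ay.
by exists y, x; rewrite ax ay.
Qed.

(** * Zeros of bounded perturbations of linear maps *)

Section Analysis.
Variable R : realType.

Lemma mx_continuous (T : topologicalType) m n (f : T -> 'M[R]_(m, n)) :
  (forall i j, continuous (fun x => f x i j)) -> continuous f.
Proof.
move=> cf x; apply/cvg_ballP => e e0.
have near_ij : \forall y \near x, forall ij : 'I_m * 'I_n,
    ball (f x ij.1 ij.2) e (f y ij.1 ij.2).
  by apply: filter_forall => ij; move/cvg_ballP: (cf ij.1 ij.2 x); exact.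
by apply: filterS near_ij => y fxy; split=> // i j; exact: (fxy (i, j)).
Qed.

Lemma add_continuous (T : topologicalType) (f g : T -> R) :
  continuous f -> continuous g -> continuous (fun x => f x + g x).
Proof. by move=> cf cg x; apply: cvgD; [exact: cf|exact: cg]. Qed.

Lemma opp_continuous (T : topologicalType) (f : T -> R) :
  continuous f -> continuous (fun x => - f x).
Proof. by move=> cf x; apply: cvgN; exact: cf. Qed.

Lemma scale_continuous (T : topologicalType) (c : R) (f : T -> R) :
  continuous f -> continuous (fun x => c * f x).
Proof. by move=> cf x; apply: cvgM; [exact: cvg_cst|exact: cf]. Qed.

Lemma comp_continuous (S T U : topologicalType) (f : S -> T) (g : T -> U) :
  continuous f -> continuous g -> continuous (fun x => g (f x)).
Proof. by move=> cf cg x; apply: continuous_comp; [exact: cf|exact: cg]. Qed.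

Lemma sum_continuous (T : topologicalType) (I : Type) (s : seq I) (P : pred I)
    (f : I -> T -> R) :
  (forall i, P i -> continuous (f i)) ->
  continuous (fun x => \sum_(i <- s | P i) f i x).
Proof.
move=> cf; elim: s => [|i s IH] x.
  by under eq_fun do rewrite big_nil; exact: cvg_cst.
under eq_fun do rewrite big_cons.
by case: ifP => Pi; [apply: continuousD; [exact: cf|exact: IH]|exact: IH].
Qed.

Lemma mulmx_continuous m n p (A : 'M[R]_(m, n)) :
  continuous (fun x : 'M[R]_(n, p) => A *m x).
Proof.
apply: mx_continuous => i j; under eq_fun do rewrite mxE.
apply: sum_continuous => k _ x.
apply: (@continuousM R _ (fun=> A i k) (fun y : 'M[R]_(n, p) => y k j)).
  exact: cst_continuous.
exact: coord_continuous.
Qed.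

Lemma cube_compact n (a b : R) :
  compact [set x : 'cV[R]_n | forall i, a <= x i ord0 <= b].
Proof.
have cptT : compact (@trmx R 1 n @` [set v : 'rV[R]_n | forall i, (v ord0 i \in `[a, b])]).
  apply: continuous_compact.
    apply/continuous_subspaceT/mx_continuous => i j.
    by under eq_fun do rewrite mxE; exact: coord_continuous.
  exact: (@rV_compact R n (fun=> [set` `[a, b]]) (fun=> @segment_compact _ a b)).
have <- // : @trmx R 1 n @` [set v : 'rV[R]_n | forall i, (v ord0 i \in `[a, b])] =
  [set x : 'cV[R]_n | forall i, a <= x i ord0 <= b].
apply/seteqP; split => [_ [y yab <-] i|x xab].
  by have := yab i; rewrite /= in_itv /= mxE.
by exists (x^T); rewrite ?trmxK // => i; rewrite /= in_itv /= mxE; exact: xab.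
Qed.

(** Brouwer's theorem in the form of Poincare and Miranda. The sign of the j-th
    coordinate of x + f(x) is forced on the two faces orthogonal to j of a large
    cube; fine grids give small cells on which every coordinate changes sign, and
    a cluster point of such cells is a zero. *)
Lemma bounded_perturbation_zero d (f : 'I_d -> 'cV[R]_d -> R) (M : R) :
  (forall j, continuous (f j)) -> (forall j x, `|f j x| <= M) ->
  exists x : 'cV[R]_d, forall j, x j ord0 + f j x = 0.
Proof.
move=> cf bf; pose K : R := `|M| + 1; have K0 : 0 < K by rewrite ltr_wpDl.
pose pt N (z : {ffun 'I_d -> nat}) : 'cV[R]_d :=
  \col_i (- K + (z i)%:R * (2 * K / N.+1%:R)).
pose g j (x : 'cV[R]_d) := x j ord0 + f j x.
have fK j x : `|f j x| < K.
  by rewrite (le_lt_trans (bf j x)) // (le_lt_trans (ler_norm _)) // /K ltrDl.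
have cell N : exists z : {ffun 'I_d -> nat}, (forall i, (z i < N.+1)%N) /\
  forall j, exists x y : {ffun 'I_d -> nat},
    [/\ 0 < g j (pt N x), g j (pt N y) <= 0,
    forall i, (z i <= x i <= (z i).+1)%N & forall i, (z i <= y i <= (z i).+1)%N].
  have [j z z0|j z zN|z zN zP] :=
    @discrete_poincare_miranda d N.+1 (fun j z => 0 < g j (pt N z)).
  - apply/negbTE; rewrite -leNgt /g mxE z0 mul0r addr0 addrC subr_le0.
    by rewrite (le_trans (ler_norm _)) // ltW.
  - rewrite /g mxE zN mulrC divfK ?pnatr_eq0 //.
    have /ltr_normlP[_ +] := fK j (pt N z); have /ltr_normlP[+ _] := fK j (pt N z).
    by lra.
  - exists z; split=> // j; have [x [y [gx gy zx zy]]] := zP j.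
    by exists x, y; split; rewrite ?leNgt.
have [z /all_and2[zN zP]] := choice cell.
pose C := [set x : 'cV[R]_d | forall i, - K <= x i ord0 <= K].
have zC : ((fun N => pt N (z N)) @ \oo) C.
  suff : \forall N \near \oo, C (pt N (z N)) by [].
  apply: nearW => N i; rewrite mxE; have := ltnW (zN N i); rewrite -(@ler_nat R) => zi.
  have N0 : 0 < N.+1%:R :> R by rewrite ltr0n.
  have -> : (z N i)%:R * (2 * K / N.+1%:R) = (2 * K) * ((z N i)%:R / N.+1%:R) by ring.
  have : 0 <= (z N i)%:R / N.+1%:R :> R by rewrite divr_ge0.
  have : (z N i)%:R / N.+1%:R <= 1 :> R by rewrite ler_pdivrMr // mul1r.
  set t := _ / _ => t1 t0; apply/andP; split; nra.
have [x [_ clx]] := @cube_compact d (- K) K _ _ zC.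
exists x => j; apply/eqP; rewrite -[_ == _]negbK; apply/negP => gx0.
have cg : continuous (g j).
  by move=> y; apply: continuousD; [exact: coord_continuous|exact: cf].
have : \forall y \near x, `|g j x - g j y| < `|g j x|.
  have /cvgr_dist_lt := cg x; apply; by rewrite normr_gt0.
move=> /nbhs_ballP[e /= e0 gball].
(* A cell so close to x, and so small, that g j keeps a constant sign on it. *)
have [v [[N Ne ->] xv]] : [set v | exists2 N, 2 * K / N.+1%:R < e / 2 & v = pt N (z N)]
    `&` ball x (e / 2) !=set0.
  apply: clx; last by apply: nbhsx_ballx; rewrite divr_gt0.
  suff : \forall N \near \oo, 2 * K / N.+1%:R < e / 2.
    by apply: filterS => N Ne; exists N.
  have : (fun N => (2 * K) * N.+1%:R^-1) @ \oo --> (2 * K) * 0.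
    by apply: cvgMr; exact: cvg_harmonic.
  rewrite mulr0 => /cvgr0_norm_lt/(_ (e / 2)); rewrite divr_gt0 // => /(_ isT).
  by apply: filterS => N; apply: le_lt_trans; exact: ler_norm.
have [a [b [ga gb za zb]]] := zP N j.
have near_cell (w : {ffun 'I_d -> nat}) :
    (forall i, (z N i <= w i <= (z N i).+1)%N) -> ball x e (pt N w).
  move=> zw; split => // i k; rewrite (ord1 k).
  have [_ /(_ i ord0)] := xv; rewrite /ball /= !mxE.
  have /andP[] := zw i; rewrite -!(ler_nat R) -[_.+1%:R]natr1 => zw1 zw2.
  rewrite !ltr_norml => /andP[x1 x2].
  move: Ne; have : 0 <= 2 * K / N.+1%:R by rewrite divr_ge0 // mulr_ge0 // ltW.
  set h := 2 * K / N.+1%:R in x1 x2 * => h0 he.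
  have m1 : 0 <= ((w i)%:R - (z N i)%:R) * h by rewrite mulr_ge0 // subr_ge0.
  have m2 : 0 <= ((z N i)%:R + 1 - (w i)%:R) * h by rewrite mulr_ge0 // subr_ge0.
  by apply/andP; split; lra.
have := gball _ (near_cell _ za); have := gball _ (near_cell _ zb).
by rewrite /=; case: (ger0P (g j x)) => gx; rewrite !ltr_norml => /andP[? ?] /andP[? ?]; lra.
Qed.

Lemma bounded_perturbation_surj d n (P : 'M[R]_(d, n)) (f : 'I_d -> 'cV[R]_n -> R)
    (M : R) : row_free P ->
  (forall j, continuous (f j)) -> (forall j x, `|f j x| <= M) ->
  exists x : 'cV[R]_n, forall j, (P *m x) j ord0 + f j x = 0.
Proof.
move=> /row_freeP[Q PQ] cf bf.
have [j|j x|y yP] := @bounded_perturbation_zero d (fun j y => f j (Q *m y)) M.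
- move=> y; apply: (@continuous_comp _ _ _ (mulmx Q) (f j)).
    exact: mulmx_continuous.
  exact: cf.
- exact: bf.
by exists (Q *m y) => j; rewrite mulmxA PQ mul1mx.
Qed.

End Analysis.

(** * Hyperbolic integer factors in degree at most three *)

Lemma horner_size4 (K : comNzRingType) (p : {poly K}) x : (size p <= 4)%N ->
  p.[x] = p`_0 + p`_1 * x + p`_2 * x ^+ 2 + p`_3 * x ^+ 3.
Proof.
move=> sp; rewrite (horner_coef_wide x sp) !big_ord_recl big_ord0 /=.
by rewrite expr0 mulr1 expr1 addr0 !addrA.
Qed.

Lemma int_unit_norm1 (k : int) : (k \is a GRing.unit) -> `|k| = 1.
Proof. by move=> /mulrV; set l := k^-1; nia. Qed.

Lemma int_norm1_factor (x y : int) : `|x * y| = 1 -> `|x| = 1.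
Proof.
rewrite -!abszE abszM => -[/eqP]; rewrite muln_eq1 => /andP[/eqP -> _] //.
Qed.

Lemma int_norm1 (k : int) : `|k| = 1 -> k = 1 \/ k = -1.
Proof. by lia. Qed.

Definition not_root_of_unity (C : numClosedFieldType) (a : C) :=
  forall k, (0 < k)%N -> a ^+ k != 1.

(** The row [v *m A ^+ i]. Matrix powers are avoided because they require a
    dimension of the form [n.+1]. *)
Definition row_iter (K : comNzRingType) n (A : 'M[K]_n) (v : 'rV[K]_n) i : 'rV[K]_n :=
  iter i (mulmxr A) v.

Lemma mul_horner_mx (K : comNzRingType) n (A : 'M[K]_n.+1) (v : 'rV[K]_n.+1)
    (p : {poly K}) d :
  (size p <= d)%N ->
  v *m horner_mx A p = \sum_(i < d) p`_i *: row_iter A v i.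
Proof.
move=> pd; rewrite -{1}[p]coefK poly_def rmorph_sum /= mulmx_sumr.
rewrite (big_ord_widen d (fun i => v *m horner_mx A (p`_i *: 'X^i)) pd) big_mkcond.
apply: eq_bigr => i _.
have -> : v *m horner_mx A (p`_i *: 'X^i) = p`_i *: row_iter A v i.
  rewrite linearZ /= rmorphXn /= horner_mx_X -scalemxAr; congr (_ *: _).
  by elim: (nat_of_ord i) => [|k IH]; rewrite ?expr0 ?mulmx1 // exprSr mulmxA IH.
by case: ltnP => // pi; rewrite nth_default // scale0r.
Qed.

Section Hyperbolic.
Variable C : numClosedFieldType.
Local Notation cpoly q := (map_poly (intr : int -> C) q).

Lemma strip_unit_roots (p : {poly int}) (a : C) : p \is monic -> `|p`_0| = 1 ->
  root (cpoly p) a -> not_root_of_unity a ->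
  exists q, [/\ q \is monic, `|q`_0| = 1, root (cpoly q) a, (size q <= size p)%N
    & q.[1] != 0 /\ q.[-1] != 0].
Proof.
move=> + + + nra; have [m] := ubnP (size p); elim: m p => // m IH p sp pm p0 pa.
have a1 : a != 1 by have := nra 1%N isT; rewrite expr1.
have aN1 : a != -1 by apply: contraNneq (nra 2%N isT) => ->; rewrite sqrrN expr1n.
have strip e : `|e| = 1 -> a != e%:~R -> p.[e] = 0 ->
  exists q, [/\ q \is monic, `|q`_0| = 1, root (cpoly q) a, (size q <= size p)%N
    & q.[1] != 0 /\ q.[-1] != 0].
  move=> e1 ae /rootP/factor_theorem[r pE].
  have rm : r \is monic by rewrite -(monicMr _ (monicXsubC e)) -pE.
  have sr : size p = (size r).+1.
    by rewrite pE size_Mmonic ?monic_neq0 ?monicXsubC // size_XsubC addn2.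
  have r0 : `|r`_0| = 1.
    move: p0; rewrite pE coefM big_ord_recl big_ord0 /= addr0 subn0.
    by rewrite coefB coefX coefC /= sub0r normrM normrN e1 mulr1.
  have ra : root (cpoly r) a.
    move: pa; rewrite pE rmorphM /= rootM => /orP[//|].
    by rewrite map_polyXsubC root_XsubC (negbTE ae).
  have [|q [qm q0 qa sq q1]] := IH r _ rm r0 ra; first by rewrite -ltnS -sr.
  by exists q; split=> //; rewrite sr (leq_trans sq).
have [|p1] := eqVneq p.[1] 0; first by apply: strip.
have [|pN1] := eqVneq p.[-1] 0; first by apply: strip; rewrite ?normrN1 ?rmorphN.
by exists p.
Qed.

(** Gauss's lemma: a rational root comes from an integer factor of degree 1,
    whose two coefficients divide 1 and q(0) respectively. *)
Lemma unit_ratroot (q : {poly int}) (x : rat) : q \is monic -> `|q`_0| = 1 ->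
  root (map_poly intr q) x -> q.[1] = 0 \/ q.[-1] = 0.
Proof.
move=> qm q0; rewrite -dvdp_XsubCl => /dvdpP_rat_int[p [c c0 pE] [r qE]].
have sp : size p = 2%N.
  by rewrite -size_rat_int_poly -(size_scale (map_poly intr p) c0) -pE size_XsubC.
have pl : p`_1 * lead_coef r = 1.
  by rewrite -(monicP qm) qE lead_coefM [lead_coef p]lead_coefE sp.
have pc : p`_0 * r`_0 = q`_0 by rewrite qE coefM big_ord1.
have ph y : p.[y] = p`_0 + p`_1 * y.
  rewrite horner_size4 ?sp // [p`_2]nth_default ?sp // [p`_3]nth_default ?sp //.
  by rewrite !mul0r !addr0.
have pc1 : `|p`_0| = 1 by move: q0; rewrite -pc => /int_norm1_factor.
have pl1 : `|p`_1| = 1 by apply: (@int_norm1_factor _ (lead_coef r)); rewrite pl.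
rewrite qE !hornerM !ph.
have [E|E] : p`_0 + p`_1 * 1 = 0 \/ p`_0 + p`_1 * -1 = 0 by lia.
  by left; rewrite E mul0r.
by right; rewrite E mul0r.
Qed.

Lemma cubic_irreducible_rat (q : {poly int}) (a : C) : q \is monic -> `|q`_0| = 1 ->
  (size q <= 4)%N -> root (cpoly q) a -> q.[1] != 0 -> q.[-1] != 0 ->
  irreducible_poly (map_poly (intr : int -> rat) q).
Proof.
move=> qm q0 sq qa q1 qN1; apply: cubic_irreducible => [|x].
  rewrite size_map_poly_id0 ?(monicP qm) ?oner_eq0 // sq andbT ltnNge.
  apply/negP => /size1_polyC qC; move: qa; rewrite qC map_polyC /= rootC intr_eq0.
  by apply/negP; move: q0; rewrite -normr_eq0 => ->.
by apply/negP => /(unit_ratroot qm q0)[]/eqP; apply/negP.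
Qed.

(** If z is a root with |z| = 1, then so is its conjugate 1/z, hence z is also a
    root of the reciprocal polynomial. In degree 3, subtracting the two equations
    leaves a linear factor, which forces q(1) = 0 or q(-1) = 0. In degree 2 it
    forces q = X^2 + b X + 1 with |b| <= 2, and the remaining values b = -1, 0, 1
    give cyclotomic polynomials. *)
Lemma no_circle_root (q : {poly int}) (a z : C) : q \is monic -> `|q`_0| = 1 ->
  (size q <= 4)%N -> root (cpoly q) a -> not_root_of_unity a ->
  q.[1] != 0 -> q.[-1] != 0 -> root (cpoly q) z -> `|z| != 1.
Proof.
move=> qm q0 sq qa nra q1 qN1 qz; apply/eqP => z1.
have sqC : (size (cpoly q) <= 4)%N by rewrite (leq_trans (size_poly _ _)).
have ev x : root (cpoly q) x ->
    (q`_0)%:~R + (q`_1)%:~R * x + (q`_2)%:~R * x ^+ 2 + (q`_3)%:~R * x ^+ 3 = 0 :> C.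
  by move=> /rootP; rewrite (horner_size4 _ sqC) !coef_map.
have q1E : q.[1] = q`_0 + q`_1 + q`_2 + q`_3 by rewrite horner_size4 //; ring.
have qN1E : q.[-1] = q`_0 - q`_1 + q`_2 - q`_3 by rewrite horner_size4 //; ring.
have z0 : z != 0 by rewrite -normr_gt0 z1.
have zc : z * z^* = 1 by rewrite -normCK z1 expr1n.
have qzc : root (cpoly q) z^*.
  apply/rootP; rewrite (_ : cpoly q = map_poly Num.conj (cpoly q)) ?horner_map /= ?(rootP qz) ?rmorph0 //.
  by apply/polyP => i; rewrite !coef_map /= rmorph_int.
have zint e : q.[e] != 0 -> z != e%:~R.
  apply: contraNneq => ze; have := rootP qz.
  by rewrite ze horner_map /= => /eqP; rewrite intr_eq0.
have z1' : z - 1 != 0 by rewrite subr_eq0; exact: (zint 1).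
have zN1' : z + 1 != 0 by rewrite -[1]opprK subr_eq0; exact: (zint (-1)).
(* The equation at the conjugate of z, multiplied by z ^+ 3. *)
have rec : (q`_0)%:~R * z ^+ 3 + (q`_1)%:~R * z ^+ 2 + (q`_2)%:~R * z + (q`_3)%:~R = 0 :> C.
  transitivity (((q`_0)%:~R + (q`_1)%:~R * z^* + (q`_2)%:~R * z^* ^+ 2 +
     (q`_3)%:~R * z^* ^+ 3) * z ^+ 3); last by rewrite ev ?mul0r.
  move: zc; set w := z^* => zc.
  transitivity ((q`_0)%:~R * z ^+ 3 + (q`_1)%:~R * (z * w) * z ^+ 2 +
    (q`_2)%:~R * (z * w) ^+ 2 * z + (q`_3)%:~R * (z * w) ^+ 3); last by ring.
  by rewrite zc !expr1n !mulr1.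
have := monicP qm; rewrite lead_coefE.
have lq : (0 < size q)%N by rewrite size_poly_gt0 monic_neq0.
have high k : (size q <= k)%N -> q`_k = 0 by exact: nth_default.
move: (ev _ qz) (ev _ qa) rec q0 q1 qN1; rewrite q1E qN1E.
have [] // : [\/ size q = 1, size q = 2, size q = 3 | size q = 4]%N.
  by move: sq lq; case: (size q) => [|[|[|[|[|]]]]] //; [constructor 1|constructor 2|constructor 3|constructor 4].
- move=> s1; rewrite s1 /= => _ + _ _ _ _ e1; rewrite e1 !high ?s1 // !mul0r !addr0.
  by move/eqP; rewrite oner_eq0.
- move=> s2; rewrite s2 /= => _ _ _ q0 q1 qN1 e1; move: q0 q1 qN1.
  by rewrite e1 [q`_2]high ?s2 // [q`_3]high ?s2 //; lia.
- move=> s3; rewrite s3 /= => ez ea rec q0 q1 qN1 e1.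
  move: ez ea rec q0 q1 qN1; rewrite e1 [q`_3]high ?s3 //.
  move: q`_0 q`_1 => e b ez ea rec /int_norm1[] eE; rewrite eE in ez ea rec *; last first.
    have /eqP : b%:~R * z ^+ 2 * 2 = 0 :> C.
      by rewrite -[RHS](addr0 0) -[in X in X + _](mulr0 z) -{1}ez -rec; ring.
    rewrite !mulf_eq0 (negbTE z0) intr_eq0 pnatr_eq0 !orbF => /eqP ->.
    by lia.
  move=> q1 qN1.
  have bE : b%:~R = - (z + z^* ) :> C.
    have zz : b%:~R * z = - (z ^+ 2 + 1) by apply/eqP; rewrite -addr_eq0 -ez; apply/eqP; ring.
    transitivity (b%:~R * (z * z^* )); first by rewrite zc mulr1.
    rewrite mulrA zz; transitivity (- (z * (z * z^* ) + z^* )); first by ring.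
    by rewrite zc mulr1.
  have bC : `|b%:~R| <= 2%:~R :> C.
    by rewrite bE normrN (le_trans (ler_normD _ _)) // norm_conjC z1.
  have {bC} b2 : `|b| <= 2 by move: bC; rewrite -intr_norm ler_int.
  have [b0|[b1|b1]] : b = 0 \/ b = 1 \/ b = -1 by lia.
  + have := nra 4%N isT; apply/negP; rewrite negbK -subr_eq0; apply/eqP.
    rewrite b0 in ea; transitivity ((a ^+ 2 - 1) * 0); last by rewrite mulr0.
    by rewrite -ea; ring.
  + have := nra 3%N isT; apply/negP; rewrite negbK -subr_eq0; apply/eqP.
    rewrite b1 in ea; transitivity ((a - 1) * 0); last by rewrite mulr0.
    by rewrite -ea; ring.
  + have := nra 6%N isT; apply/negP; rewrite negbK -subr_eq0; apply/eqP.
    rewrite b1 in ea; transitivity ((a ^+ 3 - 1) * (a + 1) * 0); last by rewrite mulr0.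
    by rewrite -ea; ring.
- move=> s4; rewrite s4 /= => ez ea rec q0 q1 qN1 e1.
  move: ez ea rec q0 q1 qN1; rewrite e1.
  move: q`_0 q`_1 q`_2 => e b c ez ea rec /int_norm1[] eE; rewrite eE in ez ea rec *.
    have /eqP : (c - b)%:~R * z * (z - 1) = 0 :> C.
      by rewrite -[RHS](subrr 0) -{1}ez -rec; ring.
    by rewrite !mulf_eq0 (negbTE z0) (negbTE z1') intr_eq0 !orbF subr_eq0 => /eqP ->; lia.
  have /eqP : (c + b)%:~R * z * (z + 1) = 0 :> C.
    by rewrite -[RHS](addr0 0) -{1}ez -rec; ring.
  by rewrite !mulf_eq0 (negbTE z0) (negbTE zN1') intr_eq0 !orbF addr_eq0 => /eqP ->; lia.
Qed.


(** An eigenvector for a shows that q(L) is singular over C, hence over the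
    integers. *)
Lemma exists_annihilated_row n (L : 'M[int]_n.+1) (q : {poly int}) (a : C) :
  eigenvalue (map_mx intr L) a -> root (cpoly q) a ->
  exists2 v : 'rV[int]_n.+1, v != 0 & v *m horner_mx L q = 0.
Proof.
move=> /eigenvalueP[w wL w0] qa; apply/det0P.
rewrite -(intr_eq0 C) -[_%:~R]/((intr : int -> C) _) -det_map_mx map_horner_mx.
apply/det0P; exists w => //.
rewrite (mul_horner_mx _ _ (leqnn _)).
have row_iterE i : row_iter (map_mx intr L) w i = a ^+ i *: w.
  elim: i => [|i IH]; first by rewrite expr0 scale1r.
  by rewrite /row_iter iterS -/(row_iter _ _ _) IH /= -scalemxAl wL scalerA -exprSr.
under eq_bigr => i _ do rewrite row_iterE scalerA.
by rewrite -scaler_suml -horner_coef (rootP qa) scale0r.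
Qed.

End Hyperbolic.

Lemma row_iter_map (K1 K2 : comNzRingType) (f : {rmorphism K1 -> K2}) n (A : 'M[K1]_n) v i :
  map_mx f (row_iter A v i) = row_iter (map_mx f A) (map_mx f v) i.
Proof. by elim: i => //= i IH; rewrite map_mxM IH. Qed.

(** A dependency would be a nonzero polynomial p of smaller degree with
    v p(A) = 0; as p is coprime to q, Bezout's identity would give v = 0. *)
Lemma irreducible_cyclic_free (K : fieldType) n (A : 'M[K]_n.+1) (v : 'rV[K]_n.+1)
    (q : {poly K}) d : irreducible_poly q -> v != 0 -> v *m horner_mx A q = 0 ->
  (d < size q)%N -> row_free (\matrix_(i < d) row_iter A v i).
Proof.
move=> qirr v0 vq dq; rewrite -kermx_eq0; apply: contraNT v0.
case/rowV0Pn => c /sub_kermxP cM c0; pose p := rVpoly c.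
have vp : v *m horner_mx A p = 0.
  rewrite (mul_horner_mx _ _ (size_poly _ _)); apply: etrans cM.
  rewrite mulmx_sum_row; apply: eq_bigr => i _.
  by rewrite rowK coef_rVpoly_ord.
have p0 : p != 0.
  by apply: contraNneq c0 => p0; rewrite -[c]rVpolyK -/p p0 linear0.
have cop : coprimep q p.
  rewrite irreducible_poly_coprime //; apply/negP => /(dvdp_leq p0).
  by rewrite leqNgt => /negP; apply; rewrite (leq_ltn_trans (size_poly _ _)).
have /Bezout_coprimepP[[s t] /=] := cop; rewrite -size_poly_eq1 => /size_poly1P[e e0 E].
have : v *m horner_mx A (s * q + t * p) = 0.
  rewrite [s * q]mulrC [t * p]mulrC rmorphD !rmorphM /= mulmxDr !mulmxA vq vp.
  by rewrite !mul0mx addr0.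
rewrite E horner_mx_C mul_mx_scalar => /eqP.
by rewrite scaler_eq0 (negbTE e0).
Qed.

(** The complex numbers in which the eigenvalues live and the field in which the
    rows are to be independent are kept separate: independence is proved over the
    rationals, where q is irreducible, and survives any extension. *)
Lemma exists_hyperbolic_factor (C : numClosedFieldType) (K : numFieldType) n
    (L : 'M[int]_n) (a : C) : (n < 5)%N -> L \in unitmx ->
  eigenvalue (map_mx intr L : 'M[C]_n) 1 -> eigenvalue (map_mx intr L) a ->
  not_root_of_unity a ->
  exists (q : {poly int}) (d : nat) (v : 'rV[int]_n),
    [/\ q \is monic, `|q`_0| = 1, size q = d.+1, (0 < d)%N &
    [/\ forall z : C, root (map_poly intr q) z -> `|z| != 1,
      \sum_(i < size q) q`_i *: row_iter L v i = 0 &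
      row_free (\matrix_(i < d) (map_mx intr (row_iter L v i) : 'rV[K]_n))]].
Proof.
case: n L => [|n] L n5 Lu eig1 eiga nra.
  by case/eigenvalueP: eig1 => w _; rewrite (thinmx0 w) eqxx.
have rootE z : eigenvalue (map_mx intr L) z = root (map_poly (intr : int -> C) (char_poly L)) z.
  by rewrite eigenvalue_root_char -map_char_poly.
have chi0 : `|(char_poly L)`_0| = 1.
  by rewrite char_poly_det normrM normrX normrN1 expr1n mul1r; apply: int_unit_norm1.
have [r chiE] : exists r, char_poly L = r * ('X - 1%:P).
  apply/factor_theorem; rewrite rootE in eig1.
  by move: eig1; rewrite /root -[1 in X in X -> _](rmorph1 (intr : int -> C)) horner_map /= intr_eq0.
have rm : r \is monic.
  by rewrite -(monicMr _ (monicXsubC (1 : int))) -chiE char_poly_monic.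
have sr : size r = n.+1.
  apply: succn_inj; rewrite -(size_char_poly L) chiE.
  by rewrite size_Mmonic ?monic_neq0 ?monicXsubC // size_XsubC addn2.
have r0 : `|r`_0| = 1.
  by move: chi0; rewrite chiE coefM big_ord1 => /int_norm1_factor.
have ra : root (map_poly (intr : int -> C) r) a.
  move: eiga; rewrite rootE chiE rmorphM rootM /= map_polyXsubC root_XsubC /= => /orP[//|].
  by move=> /eqP a1; have := nra 1%N isT; rewrite a1 rmorph1 expr1n eqxx.
have [q [qm q0 qa sqr [q1 qN1]]] := strip_unit_roots rm r0 ra nra.
have sq : (size q <= 4)%N by rewrite (leq_trans sqr) // sr.
have qirr := cubic_irreducible_rat qm q0 sq qa q1 qN1.
have [v v0 vq] := exists_annihilated_row eiga qa.
have sqd : size q = (size q).-1.+1 by rewrite prednK // size_poly_gt0 monic_neq0.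
exists q, (size q).-1, v; split=> //.
  by case: qirr => + _; rewrite size_rat_int_poly; case: (size q) => [|[]].
split=> [z||].
- exact: (no_circle_root qm q0 sq qa nra q1 qN1).
- by rewrite -(mul_horner_mx _ _ (leqnn _)).
pose vQ : 'rV[rat]_n.+1 := map_mx intr v.
have vQ0 : vQ != 0.
  apply: contraNneq v0 => /matrixP vQ0; apply/eqP/matrixP => i j.
  by have := vQ0 i j; rewrite !mxE => /eqP; rewrite intr_eq0 => /eqP.
have vQq : vQ *m horner_mx (map_mx intr L) (map_poly intr q) = 0.
  by rewrite -map_horner_mx -map_mxM vq map_mx0.
have := irreducible_cyclic_free qirr vQ0 vQq (d := (size q).-1).
rewrite size_rat_int_poly {2}sqd leqnn => /(_ isT).
rewrite -(row_free_map (ratr : rat -> K)); congr row_free.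
apply/matrixP => i j; rewrite !mxE -row_iter_map mxE.
exact: ratr_int.
Qed.

(** * Inverting polynomials in the composition operator *)

Lemma lt_dist_three (R : realFieldType) (x y a b d e : R) : d < e / 3 ->
  `|y - b| <= d -> `|x - a| <= d -> `|a - b| < e / 3 -> `|x - y| < e.
Proof.
rewrite !ltr_norml !ler_norml => ? /andP[? ?] /andP[? ?] /andP[? ?].
by apply/andP; split; lra.
Qed.

Section Resolvent.
Variables (R : realType) (T : topologicalType).

(** The Weierstrass M-test with a geometric majorant. *)
Lemma continuous_dominated_series (r : nat -> T -> R) (M q : R) :
  0 <= q < 1 -> (forall k, continuous (r k)) ->
  (forall k x, `|r k x| <= M * q ^+ k) ->
  exists S : T -> R, [/\ continuous S, forall x, series (r ^~ x) @ \oo --> S x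
    & exists K, forall x, `|S x| <= K].
Proof.
move=> /andP[q0 q1] cr br.
have q1' : `|q| < 1 by rewrite ger0_norm.
pose B := M * (1 - q)^-1.
have BM : B - B * q = M.
  by rewrite -{1}(mulr1 B) -mulrBr /B divfK // subr_eq0 eq_sym lt_eqF.
have M0 (x : T) : 0 <= M.
  by have := br 0%N x; rewrite expr0 mulr1; apply: le_trans.
have B0 (x : T) : 0 <= B by rewrite divr_ge0 ?(M0 x) // subr_ge0 ltW.
have tail x m k : `|series (r ^~ x) (m + k)%N - series (r ^~ x) m| <= B * q ^+ m.
  suff : `|series (r ^~ x) (m + k)%N - series (r ^~ x) m| <=
      B * q ^+ m - B * q ^+ (m + k).
    by move=> /le_trans; apply; rewrite gerBl mulr_ge0 ?(B0 x) ?exprn_ge0.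
  elim: k => [|k IH]; first by rewrite addn0 !subrr normr0.
  rewrite addnS seriesSr.
  rewrite addrAC (le_trans (ler_normD _ _)) //.
  have := br (m + k)%N x.
  have -> : M * q ^+ (m + k) = B * q ^+ (m + k) - B * q ^+ (m + k).+1.
    by rewrite -BM exprS; ring.
  by move=> /(lerD IH)/le_trans; apply; rewrite subrKA.
have cvg_r x : series (r ^~ x) @ \oo --> lim (series (r ^~ x) @ \oo).
  apply: (@normed_cvg R R^o).
  apply: (series_le_cvg _ _ (fun k => br k x)) => [k|k|].
  - exact: normr_ge0.
  - by rewrite mulr_ge0 ?(M0 x) ?exprn_ge0.
  - exact: (@is_cvg_geometric_series R M q).
pose S x := lim (series (r ^~ x) @ \oo).
have Stail x m : `|S x - series (r ^~ x) m| <= B * q ^+ m.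
  have c1 := cvg_norm (cvgB (cvg_r x) (cvg_cst (series (r ^~ x) m))).
  have c2 : (fun k : nat => B * q ^+ m) @ \oo --> B * q ^+ m by exact: cvg_cst.
  apply: (ler_cvg_to (c1 _ _ _) c2).
  exists m => // k /= mk; rewrite -(subnKC mk); exact: tail.
exists S; split=> //; last first.
  by exists B => x; have := Stail x 0%N; rewrite /series /= big_geq // subr0 expr0 mulr1.
move=> x; apply/cvgrPdist_lt => e e0.
have [m Be] : exists m, B * q ^+ m < e / 3.
  have : (fun m => B * q ^+ m) @ \oo --> 0 by exact: (@cvg_geometric R B q).
  move=> /cvgr0_norm_lt/(_ (e / 3)); rewrite divr_gt0 // => /(_ isT) [m _ /(_ m)].
  by move=> /(_ (leqnn _)) /(le_lt_trans (ler_norm _)) ?; exists m.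
have cP : continuous (fun y => series (r ^~ y) m).
  rewrite /series /=; elim: m {Be} => [|m IH] y.
    by under eq_fun do rewrite big_geq //; exact: cst_continuous.
  under eq_fun do rewrite big_nat_recr //=.
  by apply: continuousD; [exact: IH|exact: cr].
have /cvgrPdist_lt/(_ (e / 3)) := cP x; rewrite divr_gt0 // => /(_ isT).
apply: filterS => y; have := Stail x m; have := Stail y m; move: Be.
set a := series _ m; set b := series _ m.
exact: lt_dist_three.
Qed.


Lemma iter_continuous (f : T -> T) k : continuous f -> continuous (iter k f).
Proof.
move=> cf; elim: k => [|k IH] x; first exact: cvg_id.
exact: (continuous_comp (IH x) (cf _)).
Qed.

Local Notation Re := (@complex.Re R).
Local Notation Im := (@complex.Im R).

Lemma complex_ReD (x y : R[i]) : Re (x + y) = Re x + Re y.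
Proof. by case: x y => [a b] [c d]. Qed.

Lemma complex_ImD (x y : R[i]) : Im (x + y) = Im x + Im y.
Proof. by case: x y => [a b] [c d]. Qed.

Lemma complex_ReM (x y : R[i]) : Re (x * y) = Re x * Re y - Im x * Im y.
Proof. by case: x y => [a b] [c d]. Qed.

Lemma complex_ImM (x y : R[i]) : Im (x * y) = Re x * Im y + Im x * Re y.
Proof. by case: x y => [a b] [c d]. Qed.

Definition cont_bounded (u : T -> R) :=
  continuous u /\ exists K, forall x, `|u x| <= K.

(** Complex functions are handled through their real and imaginary parts, so that
    limits and continuity only ever concern real functions. *)
Definition ccont_bounded (u : T -> R[i]) :=
  cont_bounded (Re \o u) /\ cont_bounded (Im \o u).

Lemma normc_ge_ReIm (x : R[i]) :
  `|Re x| <= Normc.normc x /\ `|Im x| <= Normc.normc x.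
Proof.
by case: x => a b /=; split; rewrite -sqrtr_sqr ler_wsqrtr // ?lerDl ?lerDr sqr_ge0.
Qed.

Lemma normcX (x : R[i]) k : Normc.normc (x ^+ k) = Normc.normc x ^+ k.
Proof.
elim: k => [|k IH]; first exact: Normc.normc1.
by rewrite !exprS Normc.normcM IH.
Qed.

(** The Neumann series: u is the sum of c^k g(theta^k x) over all k. *)
Lemma resolvent_exists (theta : T -> T) (c : R[i]) (g : T -> R[i]) :
  continuous theta -> `|c| < 1 -> ccont_bounded g ->
  exists2 u, ccont_bounded u & forall x, u x = g x + c * u (theta x).
Proof.
move=> ct c1 [[cRe [K1 bRe]] [cIm [K2 bIm]]].
have q01 : 0 <= Normc.normc c < 1.
  apply/andP; split; first by case: (c) => a b; rewrite sqrtr_ge0.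
  by move: c1; rewrite normc_def; case: (c) => a b; rewrite ltcR.
have bd (a b : R) k x : `|a| <= Normc.normc (c ^+ k) -> `|b| <= Normc.normc (c ^+ k) ->
    `|a * Re (g x)| + `|b * Im (g x)| <= (K1 + K2) * Normc.normc c ^+ k.
  move=> ha hb; rewrite mulrDl -normcX !normrM ![_ * Normc.normc _]mulrC.
  by apply: lerD; apply: ler_pM => //; [exact: bRe|exact: bIm].
have cit (h : T -> R) k : continuous h -> continuous (h \o iter k theta).
  by move=> ch x; apply: continuous_comp; [exact: iter_continuous|exact: ch].
have lin (a b : R) (h1 h2 : T -> R) : continuous h1 -> continuous h2 ->
    continuous (fun x => a * h1 x + b * h2 x).
  by move=> c1' c2' x; apply: cvgD; apply: cvgM; [exact: cvg_cst|exact: c1'|exact: cvg_cst|exact: c2'].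
pose w k x : R[i] := c ^+ k * g (iter k theta x).
have [Sr [cSr lSr bSr]] : exists S : T -> R, [/\ continuous S,
    forall x, series (fun k => Re (w k x)) @ \oo --> S x
    & exists K, forall x, `|S x| <= K].
  apply: (@continuous_dominated_series _ (K1 + K2) _ q01) => [k|k x].
    have := lin (Re (c ^+ k)) (- Im (c ^+ k)) _ _ (cit _ k cRe) (cit _ k cIm).
    by under [X in _ -> continuous X]eq_fun do rewrite /w complex_ReM -mulNr.
  have [? ?] := normc_ge_ReIm (c ^+ k).
  by rewrite complex_ReM (le_trans (ler_normB _ _)) // bd.
have [Si [cSi lSi bSi]] : exists S : T -> R, [/\ continuous S,
    forall x, series (fun k => Im (w k x)) @ \oo --> S x
    & exists K, forall x, `|S x| <= K].
  apply: (@continuous_dominated_series _ (K1 + K2) _ q01) => [k|k x].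
    have := lin (Im (c ^+ k)) (Re (c ^+ k)) _ _ (cit _ k cRe) (cit _ k cIm).
    by under [X in _ -> continuous X]eq_fun do rewrite /w complex_ImM addrC.
  have [? ?] := normc_ge_ReIm (c ^+ k).
  by rewrite complex_ImM addrC (le_trans (ler_normD _ _)) // bd.
exists (fun x => (Sr x +i* Si x)%C); first by split; split.
have wS k x : w k.+1 x = c * w k (theta x) by rewrite /w iterSr exprS mulrA.
have w0 x : w 0%N x = g x by rewrite /w expr0 mul1r.
have shift (f : R[i] -> R) (S : T -> R) x :
    (series (fun k => f (w k x)) @ \oo --> S x) ->
    (fun n => f (g x) + series (fun k => f (c * w k (theta x))) n) @ \oo --> S x.
  rewrite -cvg_shiftS => cS.
  have -> // : (fun n => f (g x) + series (fun k => f (c * w k (theta x))) n) =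
    [sequence series (fun k => f (w k x)) n.+1]_n.
  apply/funext => n; elim: n => [|n IH].
    by rewrite /series /= big_nat1 big_geq // w0 addr0.
  by rewrite seriesSr addrA IH /= [in RHS]seriesSr wS.
have lin2 (a b : R) (h1 h2 : nat -> R) n :
    series (fun k => a * h1 k + b * h2 k) n = a * series h1 n + b * series h2 n.
  by rewrite /series /= big_split /= !mulr_sumr.
move=> x; apply/eqP; rewrite eq_complex; apply/andP; split; apply/eqP.
  rewrite complex_ReD complex_ReM -mulNr.
  apply: (cvg_unique _ (shift Re Sr x (lSr x))) => //.
  have -> : (fun k => Re (c * w k (theta x))) = (fun k =>
      Re c * Re (w k (theta x)) + - Im c * Im (w k (theta x))).
    by apply/funext => k; rewrite complex_ReM mulNr.
  rewrite /mkset; under eq_fun do rewrite lin2.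
  by apply: cvgD; [exact: cvg_cst|apply: cvgD; apply: cvgM; do 1?[exact: cvg_cst]; [exact: lSr|exact: lSi]].
rewrite complex_ImD complex_ImM.
apply: (cvg_unique _ (shift Im Si x (lSi x))) => //.
under [fun k => Im (_ * _)]eq_fun do rewrite complex_ImM.
rewrite /mkset; under eq_fun do rewrite lin2.
by apply: cvgD; [exact: cvg_cst|apply: cvgD; apply: cvgM; do 1?[exact: cvg_cst]; [exact: lSi|exact: lSr]].
Qed.

End Resolvent.

Section Pdot.
Variable K : comNzRingType.

(** The polynomial [q] in the shift operator, applied to the sequence [a] and
    evaluated at 0. *)
Definition pdot (q : {poly K}) (a : nat -> K) := \sum_(i < size q) q`_i * a i.

Lemma pdotE (q : {poly K}) a N : (size q <= N)%N ->
  pdot q a = \sum_(i < N) q`_i * a i.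
Proof.
move=> qN; rewrite /pdot (big_ord_widen N (fun i => q`_i * a i) qN) big_mkcond.
by apply: eq_bigr => i _; case: ltnP => // qi; rewrite nth_default ?mul0r.
Qed.

Lemma pdotB p q a : pdot (p - q) a = pdot p a - pdot q a.
Proof.
pose N := maxn (size p) (maxn (size q) (size (p - q))).
rewrite !(@pdotE _ a N) /N ?leq_max ?leqnn ?orbT // -sumrB.
by apply: eq_bigr => i _; rewrite coefB mulrBl.
Qed.

Lemma pdotZ c q a : pdot (c *: q) a = c * pdot q a.
Proof.
rewrite (@pdotE _ a (size q)) ?size_scale_leq // mulr_sumr.
by apply: eq_bigr => i _; rewrite coefZ mulrA.
Qed.

Lemma pdotXM q a : pdot ('X * q) a = pdot q (fun i => a i.+1).
Proof.
rewrite mulrC (@pdotE _ a (size q).+1); last first.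
  by rewrite (leq_trans (size_polyMleq _ _)) // size_polyX addn2.
rewrite big_ord_recl coefMX /= mul0r add0r.
by apply: eq_bigr => i _; rewrite coefMX.
Qed.

End Pdot.

Section Surj.
Variables (R : realType) (T : topologicalType) (phi psi : T -> T).
Hypotheses (cphi : continuous phi) (cpsi : continuous psi).
Hypothesis phiK : cancel phi psi.

Lemma ccont_bounded_lin (c : R[i]) (u : T -> R[i]) (th : T -> T) : continuous th ->
  ccont_bounded u -> ccont_bounded (fun x => c * u (th x)).
Proof.
move=> cth [[cr [K1 b1]] [ci [K2 b2]]].
have comp (h : T -> R) : continuous h -> continuous (h \o th).
  by move=> ch x; apply: continuous_comp; [exact: cth|exact: ch].
have bd (a b : R) x : `|a * complex.Re (u x)| + `|b * complex.Im (u x)| <= `|a| * K1 + `|b| * K2.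
  by rewrite !normrM; apply: lerD; apply: ler_wpM2l => //; [exact: b1|exact: b2].
split; split.
- have -> : @complex.Re R \o (fun x => c * u (th x)) = (fun x =>
      complex.Re c * complex.Re (u (th x)) + - complex.Im c * complex.Im (u (th x))).
    by apply/funext => x; rewrite /= complex_ReM mulNr.
  move=> x; apply: cvgD; apply: cvgM; do 1?[exact: cvg_cst]; [exact: (comp _ cr)|exact: (comp _ ci)].
- exists (`|complex.Re c| * K1 + `|complex.Im c| * K2) => x.
  by rewrite /= complex_ReM (le_trans (ler_normB _ _)).
- have -> : @complex.Im R \o (fun x => c * u (th x)) = (fun x =>
      complex.Re c * complex.Im (u (th x)) + complex.Im c * complex.Re (u (th x))).
    by apply/funext => x; rewrite /= complex_ImM.
  move=> x; apply: cvgD; apply: cvgM; do 1?[exact: cvg_cst]; [exact: (comp _ ci)|exact: (comp _ cr)].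
- exists (`|complex.Im c| * K1 + `|complex.Re c| * K2) => x.
  by rewrite /= complex_ImM addrC (le_trans (ler_normD _ _)).
Qed.

(** For |c| < 1 the equation is a fixed point equation along psi, the inverse of
    phi; for |c| > 1 it is one along phi with ratio 1/c. Both are solved by
    [resolvent_exists]. *)
Lemma shift_sub_scalar_surj (c : R[i]) (g : T -> R[i]) : `|c| != 1 ->
  ccont_bounded g ->
  exists2 u, ccont_bounded u & forall x, u (phi x) - c * u x = g x.
Proof.
move=> c1 cg; have [lt1|gt1] : `|c| < 1 \/ 1 < `|c|.
  by apply/orP; rewrite -real_neqr_lt ?normr_real.
- have cg' : ccont_bounded (g \o psi).
    have := ccont_bounded_lin 1 cpsi cg.
    by under [fun x => 1 * _]eq_fun do rewrite mul1r.
  have [u cu uE] := resolvent_exists cpsi lt1 cg'.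
  by exists u => // x; rewrite uE /= phiK addrK.
have c0 : c != 0 by apply: contraTneq gt1 => ->; rewrite normr0 ltr10.
have lt1 : `|c^-1| < 1 by rewrite normfV invf_lt1 // normr_gt0.
have cid : continuous (@idfun T) by move=> x; exact: cvg_id.
have [u cu uE] := resolvent_exists cphi lt1 (ccont_bounded_lin (- c^-1) cid cg).
exists u => // x; rewrite (uE x) /= mulrDr mulNr mulrN !mulrA divff // !mul1r.
by rewrite opprD addrCA opprK subrr addr0.
Qed.

Lemma poly_shift_surj_complex (rs : seq R[i]) (g : T -> R[i]) :
  all (fun z => `|z| != 1) rs -> ccont_bounded g ->
  exists2 u, ccont_bounded u & forall x,
    pdot (\prod_(z <- rs) ('X - z%:P)) (fun i => u (iter i phi x)) = g x.
Proof.
elim: rs g => [|z rs IH] g /=.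
  move=> _ cg; exists g => // x.
  by rewrite big_nil /pdot size_poly1 big_ord1 coef1 mul1r.
move=> /andP[z1 rs1] cg; have [g1 cg1 g1E] := shift_sub_scalar_surj z1 cg.
have [u cu uE] := IH _ rs1 cg1; exists u => // x.
rewrite big_cons mulrBl pdotB mul_polyC pdotZ pdotXM uE -g1E -(uE (phi x)).
by under [fun i => u (iter i phi (phi x))]eq_fun do rewrite -iterSr.
Qed.

(** Factor q over the complex numbers, invert the factors one at a time, and take
    real parts at the end, which is legitimate because q is real. *)
Lemma poly_shift_surj (q : {poly int}) (g : T -> R) : q \is monic ->
  (forall z : R[i], root (map_poly intr q) z -> `|z| != 1) ->
  cont_bounded g ->
  exists2 u, cont_bounded u & forall x,
    pdot (map_poly intr q) (fun i => u (iter i phi x)) = g x.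
Proof.
move=> qm hyp [cg [K bg]]; pose qC : {poly R[i]} := map_poly intr q.
have [rs qE] := closed_field_poly_normal qC.
have qCm : qC \is monic by exact: monic_map.
rewrite (monicP qCm) scale1r in qE.
have cgC : ccont_bounded (fun x => (g x)%:C%C).
  split; split=> //=; [by exists K|exact: cst_continuous|by exists 0 => x; rewrite normr0].
have [|u [cu _] uE] := poly_shift_surj_complex (rs := rs) _ cgC.
  by apply/allP => z zrs; apply: hyp; rewrite -/qC qE root_prod_XsubC.
exists (fun x => complex.Re (u x)) => // x.
have /(congr1 (@complex.Re R)) /= <- := uE x.
rewrite -qE /pdot /qC !size_map_poly_id0 ?(monicP qm) ?rmorph1 ?oner_neq0 //.
elim/big_rec2: _ => [//|i a b _ ->].
rewrite complex_ReD complex_ReM !coef_map /= -!(rmorph_int (real_complex R)) /=.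
by rewrite mul0r subr0.
Qed.

End Surj.

(** * Functions on the torus and minimality *)

Section TorusFacts.
Variables (R : realType) (n : nat).
Local Notation X := (torus R n).
Local Notation lat := (@lattice_vec R n).
Local Notation proj := (@torus_proj R n).

Lemma torus_projP (x y : 'cV[R]_n) : proj x = proj y <-> exists m, x = y + lat m.
Proof.
have E := @eqmodP _ (lattice_equiv R n) x y.
split=> [/E/asboolP[m xy]|[m xy]].
  by exists m; rewrite -xy addrC subrK.
by apply/E/asboolP; exists m; rewrite xy addrC addKr.
Qed.

Lemma torus_proj_repr (t : X) : proj (repr t) = t.
Proof. exact: reprK. Qed.

Lemma torus_proj_continuous : continuous proj.
Proof. exact: pi_continuous. Qed.

Definition periodic (g : 'cV[R]_n -> R) := forall x m, g (x + lat m) = g x.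

(** A periodic function takes all its values on the unit cube, which is compact. *)
Lemma periodic_bounded (g : 'cV[R]_n -> R) : continuous g -> periodic g ->
  exists K, forall x, `|g x| <= K.
Proof.
move=> cg pg; pose C := [set x : 'cV[R]_n | forall i, 0 <= x i ord0 <= 1].
have : compact (g @` C).
  by apply: continuous_compact; [exact: continuous_subspaceT|exact: cube_compact].
move=> /compact_bounded[K [_ bK]]; exists (K + 1) => x.
pose m : 'cV[int]_n := \col_i Num.floor (x i ord0).
have -> : x = (x - lat m) + lat m by rewrite subrK.
rewrite pg; apply: bK; first by rewrite ltrDl.
exists (x - lat m) => // i; rewrite !mxE.
have := floor_itv (x i ord0); rewrite intrD => /andP[? ?].
by apply/andP; split; lra.
Qed.

Lemma periodic_descends (g : 'cV[R]_n -> R) : continuous g -> periodic g ->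
  exists2 h : X -> R, cont_bounded h & forall x, h (proj x) = g x.
Proof.
move=> cg pg; have gE x : g (repr (proj x)) = g x.
  by have /torus_projP[m ->] := torus_proj_repr (proj x).
exists (fun t => g (repr t)) => //; split.
  apply/quotient_continuous; rewrite (_ : _ \o _ = g) //.
  by apply/funext => x; exact: gE.
by have [K bK] := periodic_bounded cg pg; exists K.
Qed.

Lemma open_not_int : open [set x : R | x \isn't a Num.int].
Proof.
rewrite openE => x /= xZ; have /andP[lo hi] := floor_itv x.
have lo' : (Num.floor x)%:~R < x.
  by rewrite lt_neqAle lo andbT; apply: contra xZ => /eqP <-; exact: intr_int.
apply: (@filterS _ _ _ `](Num.floor x)%:~R, (Num.floor x + 1)%:~R[%classic).
  move=> y; rewrite /= in_itv /= => /andP[ly hy]; apply/negP => /intrP[k yk].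
  by move: ly hy; rewrite yk !ltr_int ltzD1 leNgt => ->.
by apply: near_in_itvoo; rewrite in_itv /= lo' hi.
Qed.

(** The points where [s] is not an integer form an open subset of the torus. It is
    nonempty, since [s] varies by the nonzero integer [w m] along a segment and so
    takes half-integer values between. A dense orbit has to meet it. *)
Lemma minimal_no_integral_functional (phi : X -> X) (s : 'cV[R]_n -> R)
    (w : 'cV[int]_n -> int) (x0 : 'cV[R]_n) :
  minimal phi -> continuous s ->
  (forall x m, s (x + lat m) = s x + (w m)%:~R) -> (exists m, w m != 0) ->
  ~ (forall x, orbit_set phi (proj x0) (proj x) -> s x \is a Num.int).
Proof.
move=> hmin cs sw [m wm] orbZ.
have [z zZ] : exists z, s z \isn't a Num.int.
  apply: contrapT => /forallNP allZ.
  have {}allZ z : s z \is a Num.int by have /negP := allZ z; rewrite negbK.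
  pose h (t : R) := s (t *: lat m).
  have ch : continuous h.
    move=> t; apply: (@continuous_comp _ _ _ (fun t : R => t *: lat m) s); last exact: cs.
    apply: mx_continuous => i j {}t; under eq_fun do rewrite mxE.
    by apply: cvgM; [exact: cvg_id|exact: cvg_cst].
  have h01 : h 1 = h 0 + (w m)%:~R.
    by rewrite /h scale1r scale0r -sw add0r.
  have ivt c : Num.min (h 0) (h 1) <= c <= Num.max (h 0) (h 1) -> c \is a Num.int.
    by move=> hc; have [t _ <-] := IVT ler01 (continuous_subspaceT ch) hc; exact: allZ.
  have [a h0a] : exists a : int, h 0 = a%:~R by exact/intrP/allZ.
  have half (k : int) : (k%:~R + 2^-1 : R) \is a Num.int -> False.
    move=> /intrP[l kl]; have : (k%:~R : R) < l%:~R by move: kl; lra.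
    have : (l%:~R : R) < (k + 1)%:~R by rewrite intrD; move: kl; lra.
    by rewrite !ltr_int ltzD1 leNgt => /negbTE ->.
  have [w0|w0] : w m <= -1 \/ 1 <= w m by lia.
    have {}w0 : (w m)%:~R <= -1 :> R by rewrite -(ler_int R) in w0.
    apply: (half (a - 1)); apply: ivt; rewrite ge_min le_max h01 h0a intrB.
    by apply/andP; split; apply/orP; [right|left]; lra.
  have {}w0 : 1 <= (w m)%:~R :> R by rewrite -(ler_int R) in w0.
  apply: (half a); apply: ivt; rewrite ge_min le_max h01 h0a.
  by apply/andP; split; apply/orP; [left|right]; lra.
pose O := [set t : X | s (repr t) \isn't a Num.int].
have sE x : (s (repr (proj x)) \is a Num.int) = (s x \is a Num.int).
  have /torus_projP[k ->] := torus_proj_repr (proj x).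
  by rewrite sw rpredDr ?intr_int.
have oO : open O.
  rewrite /open /= /quotient_open.
  rewrite (_ : _ @^-1` O = s @^-1` [set x : R | x \isn't a Num.int]).
    by move/continuousP: cs; apply; exact: open_not_int.
  by apply/seteqP; split => x; rewrite /O /= (sE x).
have [] := hmin (proj x0) O _ oO.
  by exists (proj z); rewrite /O /= sE.
move=> t [Ot orb]; have := orbZ (repr t); rewrite torus_proj_repr => /(_ orb).
by move: Ot; rewrite /O /= => /negbTE ->.
Qed.

End TorusFacts.

(** * Linear parts of minimal homeomorphisms *)

Section Recurrence.
Variable R : realType.

Lemma pdot_int_map (q : {poly int}) (a : nat -> R) : q \is monic ->
  pdot (map_poly intr q) a = \sum_(i < size q) (q`_i)%:~R * a i.
Proof.
move=> qm; rewrite (@pdotE _ _ _ (size q)) ?size_poly //.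
by apply: eq_bigr => i _; rewrite coef_map.
Qed.

(** The leading coefficient 1 of [q] lets each term be computed from the [d]
    previous ones. *)
Lemma recurrence_int_forward (q : {poly int}) d (a : nat -> R) : q \is monic ->
  size q = d.+1 -> (forall k, pdot (map_poly intr q) (fun i => a (i + k)%N) = 0) ->
  (forall i, (i < d)%N -> a i \is a Num.int) -> forall i, a i \is a Num.int.
Proof.
move=> qm sq rec init; suff all_below N i : (i < N)%N -> a i \is a Num.int.
  by move=> i; apply: (all_below i.+1).
elim: N i => // N IH i; rewrite ltnS leq_eqVlt => /predU1P[->|]; last exact: IH.
have [/init//|dN] := ltnP N d.
have := rec (N - d)%N; rewrite pdot_int_map // sq big_ord_recr /=.
have -> : q`_d = 1 by move/monicP: qm; rewrite lead_coefE sq.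
rewrite mul1r subnKC // => /eqP; rewrite addrC addr_eq0 => /eqP ->.
rewrite rpredN rpred_sum // => k _; rewrite rpredM ?intr_int // IH //.
by rewrite -{2}(subnKC dN) ltn_add2r.
Qed.

(** The constant coefficient +-1 of [q] lets each term be computed from the [d]
    following ones. *)
Lemma recurrence_int_backward (q : {poly int}) (a : nat -> R) k : q \is monic ->
  `|q`_0| = 1 -> (0 < size q)%N ->
  (forall k, pdot (map_poly intr q) (fun i => a (i + k)%N) = 0) ->
  (forall i, a (i + k)%N \is a Num.int) -> a 0%N \is a Num.int.
Proof.
move=> qm q0 sq rec; elim: k => [aZ|k IH aZ]; first exact: (aZ 0%N).
apply: IH => -[|i]; last by rewrite addSnnS.
have := rec k; rewrite pdot_int_map //; case: (size q) sq => // d _.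
rewrite big_ord_recl /= => /eqP; rewrite addr_eq0 => /eqP E.
have sgn : (q`_0)%:~R * ((q`_0)%:~R * a (0 + k)%N) = a (0 + k)%N.
  rewrite mulrA -intrM (_ : q`_0 * q`_0 = 1) ?mul1r //.
  by move: q0; case: ger0P => _; nia.
rewrite -sgn E rpredM ?intr_int // rpredN rpred_sum // => j _.
by rewrite rpredM ?intr_int // addSnnS.
Qed.

End Recurrence.

Section Dynamics.
Variables (R : realType) (n : nat).
Local Notation X := (torus R n).
Local Notation lat := (@lattice_vec R n).
Local Notation proj := (@torus_proj R n).
Variables (phi psi : X -> X).
Hypotheses (cphi : continuous phi) (cpsi : continuous psi).
Hypothesis phiK : cancel phi psi.
Hypothesis hmin : minimal phi.

(** The orbit of a fixed point is one point, and a coordinate functional is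
    integral on its lifts. *)
Lemma minimal_no_fixed_point (x0 : 'cV[R]_n) : (0 < n)%N -> phi (proj x0) <> proj x0.
Proof.
move=> n0 fix0; pose j := Ordinal n0.
have fixk k t : iter k phi t = proj x0 -> t = proj x0.
  elim: k t => //= k IH t; rewrite -{1}fix0 => /(can_inj phiK); exact: IH.
apply: (@minimal_no_integral_functional R n phi (fun x => x j ord0 - x0 j ord0)
  (fun m => m j ord0) x0) => //.
- apply: add_continuous; [exact: coord_continuous|exact: cst_continuous].
- by move=> x m; rewrite !mxE addrAC.
- by exists (const_mx 1); rewrite mxE.
move=> x [k [xE|/esym xE]].
  have {}xE : proj x = proj x0 by rewrite xE; elim: (k) => //= l ->.
  by have /torus_projP[m ->] := xE; rewrite !mxE addrAC subrr add0r intr_int.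
by have /torus_projP[m ->] := fixk _ _ xE; rewrite !mxE addrAC subrr add0r intr_int.
Qed.

Variables (L : 'M[int]_n) (F : 'cV[R]_n -> 'cV[R]_n).
Hypotheses (cF : continuous F) (pF : forall x m, F (x + lat m) = F x).
Let LR : 'M[R]_n := map_mx intr L.
Let lift x := LR *m x + F x.
Hypothesis liftE : forall x, phi (proj x) = proj (lift x).

Lemma coord_periodic_bounded d (f : 'I_d -> 'cV[R]_n -> R) :
  (forall j, continuous (f j)) -> (forall j, periodic (f j)) ->
  exists K, forall j x, `|f j x| <= K.
Proof.
move=> cf pf; have [K bK] := choice (fun j => periodic_bounded (cf j) (pf j)).
exists (\sum_j `|K j|) => j x; rewrite (le_trans (bK j x)) //.
rewrite (le_trans (ler_norm _)) // (bigD1 j) //= lerDl.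
by apply: sumr_ge0.
Qed.

(** The case of Lefschetz's fixed point theorem where L has no eigenvalue 1. *)
Lemma lift_fixed_point : row_free (LR - 1%:M) -> exists x, phi (proj x) = proj x.
Proof.
move=> free; pose f j x := F x j ord0.
have cf j : continuous (f j).
  apply: (comp_continuous (g := fun y : 'cV[R]_n => y j ord0) cF).
  exact: coord_continuous.
have pf j : periodic (f j) by move=> x m; rewrite /f pF.
have [K bK] := coord_periodic_bounded cf pf.
have [x xE] := bounded_perturbation_surj free cf bK.
exists x; rewrite liftE; congr (proj _); apply/colP => j.
apply/eqP; rewrite -subr_eq0 -[X in _ == X](xE j) /lift mulmxBl mul1mx !mxE.
by rewrite addrAC.
Qed.

Lemma lift_lattice x m : lift (x + lat m) = lift x + lat (L *m m).
Proof. by rewrite /lift mulmxDr pF -addrA [_ + F x]addrC addrA /lattice_vec map_mxM. Qed.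

Lemma iter_lift_lattice k x m :
  iter k lift (x + lat m) = iter k lift x + lat (iter k (mulmx L) m).
Proof. by elim: k => //= k ->; rewrite lift_lattice. Qed.

Lemma iter_lift_proj k x : proj (iter k lift x) = iter k phi (proj x).
Proof. by elim: k => //= k <-; rewrite liftE. Qed.

Lemma lift_continuous : continuous lift.
Proof.
apply: mx_continuous => i j; under eq_fun do rewrite mxE.
have cij : continuous (fun y : 'cV[R]_n => y i j) by exact: coord_continuous.
apply: add_continuous; last exact: (comp_continuous cF cij).
exact: (comp_continuous (@mulmx_continuous _ _ _ _ LR) cij).
Qed.

Lemma row_iter_mul (v : 'rV[int]_n) i (m : 'cV[int]_n) :
  row_iter L v i *m m = v *m iter i (mulmx L) m.
Proof.
elim: i m => //= i IH m; by rewrite -mulmxA IH -iterSr.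
Qed.

(** Franks's semiconjugacy, in coordinates: x |-> (s(x), ..., s(Phi^(d-1) x))
    intertwines the lift with the companion matrix of [q], whose fixed point 0 is
    attained. The contradiction with minimality is read off the first coordinate
    [s]. *)
Lemma no_hyperbolic_factor (q : {poly int}) d (v : 'rV[int]_n) :
  q \is monic -> `|q`_0| = 1 -> size q = d.+1 -> (0 < d)%N ->
  (forall z : R[i], root (map_poly intr q) z -> `|z| != 1) ->
  \sum_(i < size q) q`_i *: row_iter L v i = 0 ->
  row_free (\matrix_(i < d) (map_mx intr (row_iter L v i) : 'rV[R]_n)) -> False.
Proof.
move=> qm q0 sq d0 hyp vq free.
pose lin i (x : 'cV[R]_n) : R := ((map_mx intr (row_iter L v i) : 'rV[R]_n) *m x) ord0 ord0.
have lin_lat i m : lin 0%N (lat (iter i (mulmx L) m)) = ((row_iter L v i *m m) ord0 ord0)%:~R.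
  by rewrite /lin /lattice_vec -map_mxM mxE (row_iter_mul v i).
have linD i x y : lin i (x + y) = lin i x + lin i y by rewrite /lin mulmxDr mxE.
have lin_lat' i m : lin i (lat m) = ((row_iter L v i *m m) ord0 ord0)%:~R.
  by rewrite /lin /lattice_vec -map_mxM mxE.
have clin i (h : 'cV[R]_n -> 'cV[R]_n) : continuous h -> continuous (fun x => lin i (h x)).
  move=> ch; apply: (comp_continuous (g := lin i) ch).
  apply: (comp_continuous (@mulmx_continuous _ _ _ _ _) (g := fun y : 'M[R]_1 => y ord0 ord0)).
  exact: coord_continuous.
have citer i : continuous (iter i lift) by apply: iter_continuous; exact: lift_continuous.
pose g x : R := - \sum_(i < size q) (q`_i)%:~R * lin 0%N (iter i lift x).
(* g is periodic because v q(L) = 0; correcting lin 0 by u will cancel it. *)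
have pg : periodic g.
  move=> x m; rewrite /g; congr (- _).
  under eq_bigr => i _ do rewrite iter_lift_lattice linD lin_lat mulrDr.
  rewrite big_split /= [X in _ + X](_ : _ = 0) ?addr0 //.
  have := congr1 (fun w : 'rV[int]_n => ((w *m m) ord0 ord0)%:~R : R) vq.
  rewrite mul0mx [in RHS]mxE /= => vq0; apply: etrans vq0.
  rewrite mulmx_suml summxE rmorph_sum /=.
  by apply: eq_bigr => i _; rewrite -scalemxAl !mxE intrM.
have cg : continuous g.
  apply: opp_continuous; apply: sum_continuous => i _.
  by apply: scale_continuous; exact: (clin 0%N _ (citer i)).
have [g' cg' g'E] := periodic_descends cg pg.
have [u [cu [Ku bu]] uE] := poly_shift_surj cphi cpsi phiK qm hyp cg'.
pose s x := lin 0%N x + u (proj x).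
have cup i : continuous (fun x => u (iter i phi (proj x))).
  have ci : continuous (iter i phi) by exact: iter_continuous.
  exact: (comp_continuous (@torus_proj_continuous R n) (comp_continuous ci cu)).
have cs : continuous s.
  apply: add_continuous; last exact: (cup 0%N).
  exact: (clin 0%N idfun (fun x => cvg_id)).
(* The correction makes s satisfy the recurrence exactly along the lift. *)
have rec x : pdot (map_poly intr q) (fun i => s (iter i lift x)) = 0.
  rewrite pdot_int_map //; under eq_bigr => i _ do rewrite mulrDr iter_lift_proj.
  rewrite big_split /= -(@pdot_int_map R q (fun i => u (iter i phi (proj x)))) // uE g'E.
  by rewrite subrr.
have s_lat x m : s (x + lat m) = s x + ((v *m m) ord0 ord0)%:~R.
  rewrite /s linD lin_lat' (_ : proj (x + lat m) = proj x) 1?addrAC //.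
  by apply/torus_projP; exists m.
pose f (j : 'I_d) x := s (iter j lift x) - lin j x.
have cf j : continuous (f j).
  apply: add_continuous; first exact: (comp_continuous (citer j) cs).
  by apply: opp_continuous; exact: (clin j idfun (fun x => cvg_id)).
have pf j : periodic (f j).
  move=> x m; rewrite /f iter_lift_lattice s_lat linD lin_lat' row_iter_mul.
  by rewrite opprD addrACA subrr addr0.
have [K bK] := coord_periodic_bounded cf pf.
have [x0 x0E] := bounded_perturbation_surj free cf bK.
have s0 i : (i < d)%N -> s (iter i lift x0) = 0.
  move=> id; have := x0E (Ordinal id); rewrite /f /= addrC.
  rewrite (_ : (_ *m x0) _ _ = lin i x0) ?subrK // /lin.
  by rewrite !mxE; apply: eq_bigr => k _; rewrite !mxE.
have sZ i : s (iter i lift x0) \is a Num.int.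
  apply: (@recurrence_int_forward R q d (fun i => s (iter i lift x0))) => // [k|j jd].
    by under eq_fun do rewrite iterD; exact: rec.
  by rewrite s0.
apply: (minimal_no_integral_functional hmin cs s_lat (x0 := x0)).
  have v0 : v != 0.
    apply/eqP => v0; have [B] := row_freeP free.
    move=> /matrixP/(_ (Ordinal d0) (Ordinal d0))/eqP.
    rewrite !mxE big1 ?eqxx /= => [|k _]; first by rewrite eq_sym oner_eq0.
    by rewrite !mxE /row_iter /= v0 mxE mul0r.
  have [j vj] : exists j, v ord0 j != 0.
    apply/existsP; apply: contraNT v0; rewrite negb_exists => /forallP z.
    by apply/eqP/rowP => j; rewrite mxE; apply/eqP; have := z j; rewrite negbK.
  exists (delta_mx j ord0); rewrite -colE mxE //.
move=> x [k [xE|xE]].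
  have : proj x = proj (iter k lift x0) by rewrite iter_lift_proj.
  by move=> /torus_projP[m ->]; rewrite s_lat rpredD ?intr_int.
(* Here x lies over a preimage of x0: phi^k maps its class to that of x0. *)
apply: (@recurrence_int_backward R q (fun i => s (iter i lift x)) k) => //.
- by rewrite sq.
- by move=> l; under eq_fun do rewrite iterD; exact: rec.
have : proj (iter k lift x) = proj x0 by rewrite iter_lift_proj.
move=> /torus_projP[m xm] i.
by rewrite iterD xm iter_lift_lattice s_lat rpredD ?intr_int.
Qed.

End Dynamics.

Theorem theorem1 (R : realType) (n : nat) (hn1 : (1 <= n)%N) (hn5 : (n < 5)%N)
  (phi : torus R n -> torus R n) (hphi : homeomorphism phi) (hmin : minimal phi)
  (L : 'M[int]_n) (hL : is_linear_part phi L) :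
  quasi_unipotent R L /\ eigenvalue (complex_mx R L) 1.
Proof.
have [cphi [psi [phiK _ cpsi]]] := hphi.
have [Lu [F [cF pF liftE]]] := hL.
have eig1 : eigenvalue (complex_mx R L) 1.
  rewrite -[eigenvalue _ _]negbK; apply/negP; rewrite /eigenvalue negbK /eigenspace.
  rewrite kermx_eq0 => free.
  have freeR : row_free (map_mx intr L - 1%:M : 'M[R]_n).
    rewrite -(row_free_map (real_complex R)); move: free; congr (is_true (row_free _)).
    apply/matrixP => i j; rewrite !mxE rmorphB rmorph_nat /=.
    by rewrite -(rmorph_int (real_complex R)).
  have [x] := lift_fixed_point cF pF liftE freeR.
  exact: (minimal_no_fixed_point phiK hmin hn1).
split=> // a eiga; apply: contrapT => nra.
have {}nra : not_root_of_unity a.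
  by move=> k k0; apply/eqP => ak; apply: nra; exists k.
have [q [d [v [qm q0 sq d0 [hyp vq free]]]]] :=
  exists_hyperbolic_factor R hn5 Lu eig1 eiga nra.
exact: (no_hyperbolic_factor cphi cpsi phiK hmin cF pF liftE qm q0 sq d0 hyp vq free).
Qed.
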